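(* For every fixed integer $n\ge 2$, we have $$\pi - 2\, d_{\mathrm{GH}}(S^n, S^k) = \Omega\left(\frac{1}{\sqrt{k}}\right);$$ that is, there is a constant $c>0$ (depending on $n$) such that $\pi - 2\, d_{\mathrm{GH}}(S^n, S^k)\ge \frac{c}{\sqrt{k}}$ for all integers $k>n$.
   Context: For an integer $n\ge 1$, $S^n=\{x\in\mathbb{R}^{n+1} : \langle x,x\rangle=1\}$ is the unit sphere equipped with the geodesic metric $d_{S^n}(x,x')=\arccos(\langle x,x'\rangle)$. A correspondence between sets $X$ and $Y$ is a relation $R\subseteq X\times Y$ whose coordinate projections to $X$ and to $Y$ are both surjective. For metric spaces $(X,d_X)$, $(Y,d_Y)$, the distortion of $R$ is $\operatorname{dis}(R)=\sup_{(x,y),(x',y')\in R}|d_X(x,x')-d_Y(y,y')|$. The Gromov--Hausdorff distance between compact metric spaces $X,Y$ is given by $2\,d_{\mathrm{GH}}(X,Y)=\inf_R \operatorname{dis}(R)$, the infimum being over all correspondences $R\subseteq X\times Y$. $\Omega(1/\sqrt{k})$ denotes a function of $k$ that is bounded below by a positive multiple of $1/\sqrt{k}$. *)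

(* Defs.v *)
From HB Require Import structures.
From mathcomp Require Import all_boot all_order all_algebra.
From mathcomp Require Import all_classical all_reals all_analysis.
From mathcomp Require Import ring lra.

Set Implicit Arguments.
Unset Strict Implicit.
Unset Printing Implicit Defensive.

Import Order.TTheory GRing.Theory Num.Theory.

Local Open Scope classical_set_scope.
Local Open Scope ring_scope.

Section inner_product.
Context {R : realType} {m : nat}.
Implicit Types (x y z : 'rV[R]_m) (a : R).

Definition dotr x y : R := \sum_(i < m) x 0 i * y 0 i.

Lemma dotrC x y : dotr x y = dotr y x.
Proof. by apply: eq_bigr => i _; rewrite mulrC. Qed.

Lemma dotrDl x y z : dotr (x + y) z = dotr x z + dotr y z.
Proof. by rewrite -big_split; apply: eq_bigr => i _; rewrite mxE mulrDl. Qed.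

Lemma dotrZl a x y : dotr (a *: x) y = a * dotr x y.
Proof. by rewrite mulr_sumr; apply: eq_bigr => i _; rewrite mxE mulrA. Qed.

Lemma dotrBl x y z : dotr (x - y) z = dotr x z - dotr y z.
Proof. by rewrite -scaleN1r dotrDl dotrZl mulN1r. Qed.

Lemma dotrBr x y z : dotr x (y - z) = dotr x y - dotr x z.
Proof. by rewrite dotrC dotrBl !(dotrC x). Qed.

Lemma dotrZr a x y : dotr x (a *: y) = a * dotr x y.
Proof. by rewrite dotrC dotrZl dotrC. Qed.

Lemma dotr_ge0 x : 0 <= dotr x x.
Proof. by apply: sumr_ge0 => i _; rewrite -expr2 sqr_ge0. Qed.

Lemma dotr_eq0 x : dotr x x = 0 -> x = 0.
Proof.
move=> /eqP; rewrite psumr_eq0 => [/allP x0|i _]; last by rewrite -expr2 sqr_ge0.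
apply/rowP => i; rewrite mxE; apply/eqP.
by have := x0 i (mem_index_enum i); rewrite /= mulf_eq0 orbb.
Qed.

Lemma dotr_CauchySchwarz x y : dotr x y ^+ 2 <= dotr x x * dotr y y.
Proof.
have [y0|y_neq0] := eqVneq (dotr y y) 0.
  by rewrite (dotr_eq0 y0) -(scale0r 0) !dotrZr !mul0r expr0n mulr0.
have y_gt0 : 0 < dotr y y by rewrite lt_def y_neq0 dotr_ge0.
have := dotr_ge0 (dotr y y *: x - dotr x y *: y).
rewrite !(dotrBl, dotrBr, dotrZl, dotrZr) (dotrC y x) => xy_ge0.
rewrite -subr_ge0 -(pmulr_rge0 _ y_gt0); apply: le_trans xy_ge0 _.
by rewrite le_eqVlt; apply/orP; left; apply/eqP; ring.
Qed.

End inner_product.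

Section sphere.
Context {R : realType} {n : nat}.

Record sphere := Sphere {
  sphere_val :> 'rV[R]_n.+1 ;
  _ : dotr sphere_val sphere_val == 1 }.

HB.instance Definition _ := [isSub for sphere_val].
HB.instance Definition _ := [Choice of sphere by <:].

Implicit Types x y z : sphere.

Definition sphere_dist x y : R := acos (dotr x y).

Lemma dotr_sphere x : dotr x x = 1.
Proof. by apply/eqP; case: x. Qed.

Lemma dotr_sphere_itv x y : -1 <= dotr x y <= 1.
Proof.
by have := dotr_CauchySchwarz x y; rewrite !dotr_sphere => ?; apply/andP; split; nra.
Qed.

Lemma sphere_distxx x : sphere_dist x x = 0.
Proof. by rewrite /sphere_dist dotr_sphere acos1. Qed.

Lemma sphere_dist_eq0 x y : sphere_dist x y = 0 -> x = y.
Proof.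
move=> xy0; apply/val_inj/eqP; rewrite -subr_eq0; apply/eqP/dotr_eq0 => /=.
have xy1 : dotr x y = 1.
  by rewrite -cos0 -xy0 /sphere_dist acosK// in_itv/= dotr_sphere_itv.
by rewrite !(dotrBl, dotrBr) !dotr_sphere (dotrC y) xy1 !subrr.
Qed.

Lemma sphere_distC x y : sphere_dist x y = sphere_dist y x.
Proof. by rewrite /sphere_dist dotrC. Qed.

Lemma sphere_dist_triangle y x z :
  sphere_dist x z <= sphere_dist x y + sphere_dist y z.
Proof.
have xyB := dotr_sphere_itv x y; have yzB := dotr_sphere_itv y z.
have xzB := dotr_sphere_itv x z.
have [pi_lt|le_pi] := ltP pi (sphere_dist x y + sphere_dist y z).
  by rewrite (le_trans _ (ltW pi_lt))// acos_lepi.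
have cosE (u v : sphere) : cos (sphere_dist u v) = dotr u v.
  by rewrite /sphere_dist acosK// in_itv/= dotr_sphere_itv.
rewrite leNgt -ltr_cos; first last.
- by rewrite in_itv/= acos_ge0// acos_lepi.
- by rewrite in_itv/= addr_ge0// acos_ge0.
rewrite -leNgt cosD !cosE /sphere_dist !sin_acos//.
have := dotr_CauchySchwarz (val x - dotr x y *: val y)
                             (val z - dotr y z *: val y).
rewrite !(dotrBl, dotrBr, dotrZl, dotrZr) !dotr_sphere.
rewrite (dotrC y x) (dotrC z y) => cs.
rewrite lerBlDr -lerBlDl -sqrtrM; last first.
  by move: xyB => /andP[]; nra.
rewrite (le_trans (ler_norm _))// -sqrtr_sqr ler_wsqrtr//.
by nra.
Qed.

HB.instance Definition _ := isMetric.Build R sphere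
  sphere_distxx sphere_dist_eq0 sphere_distC sphere_dist_triangle.

Lemma mdist_sphereE x y : mdist x y = acos (dotr x y).
Proof. by []. Qed.

End sphere.
Arguments sphere R n : clear implicits.

Section gromov_hausdorff.
Context {R : realType}.
Local Open Scope ereal_scope.

Definition correspondence {X Y : Type} : set (set (X * Y)) :=
  [set C | (forall x, exists y, C (x, y)) /\ (forall y, exists x, C (x, y))].

(* The distance is extended-real valued, so that no boundedness is required of
   the suprema and infima below; it is finite for (nonempty) compact spaces. *)
Definition distortion {X Y : metricType R} (C : set (X * Y)) : \bar R :=
  ereal_sup [set (`|mdist p.1 q.1 - mdist p.2 q.2|%R)%:E | p in C & q in C].

Definition gh_dist (X Y : metricType R) : \bar R :=
  (2^-1)%:E * ereal_inf [set distortion C | C in @correspondence X Y].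

End gromov_hausdorff.

(* Main.v *)
(* A correspondence that is invariant under the antipodal maps has distortion at
   most pi - d as soon as points of S^n at distance less than d only correspond
   to points of S^k at distance at most pi - d.  S^k is covered by the 2(k + 1)
   caps {± y_i >= 1 / sqrt (k + 1)}, each of diameter at most
   pi - 2 / sqrt (k + 1).  Since n >= 2, S^n contains k + 1 pairs of antipodal
   points ± p_i that are pairwise of order 1 / sqrt k apart: match ± p_i with
   the i-th pair of caps, and use the inclusion S^n -> S^k away from these
   points.  All distance estimates come from |x_i - y_i| <= d(x, y). *)
Require Import Defs.
From mathcomp Require Import all_boot all_order all_algebra.
From mathcomp Require Import all_classical all_reals all_analysis.
From mathcomp Require Import ring lra.

Set Implicit Arguments.
Unset Strict Implicit.
Unset Printing Implicit Defensive.

Import Order.TTheory GRing.Theory Num.Theory.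
Import numFieldNormedType.Exports.

Local Open Scope ring_scope.

(** * Elementary bounds on sine and cosine *)

Lemma sin_le {R : realType} (t : R) : 0 <= t -> sin t <= t.
Proof.
move=> t0; have [|c _] := @MVT_segment R sin cos 0 t t0.
  by apply/continuous_subspaceT => x; exact: continuous_sin.
by rewrite sin0 !subr0 => ->; rewrite ler_piMl// cos_le1.
Qed.

(** Half-angle formula [cos t = 1 - 2 * sin (t / 2) ^+ 2], combined with [sin_le]. *)
Lemma cos_ge_quadratic {R : realType} (t : R) :
  0 <= t <= pi -> 1 - t ^+ 2 / 2 <= cos t.
Proof.
move=> /andP[t0 tpi]; have -> : t = (t / 2) *+ 2 by rewrite mulr2n; field.
have s_le : sin (t / 2) <= t / 2 by rewrite sin_le// divr_ge0.
have s_ge0 : 0 <= sin (t / 2) by rewrite sin_ge0_pi//; apply/andP; split; lra.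
have s2 : sin (t / 2) ^+ 2 <= (t / 2) ^+ 2 by rewrite ler_sqr ?nnegrE ?divr_ge0.
rewrite cos_mulr2n cos2sin2; lra.
Qed.

(** * Angular distance versus coordinates, antipodes and caps *)

Section SphereGeometry.
Context {R : realType} {n : nat}.
Implicit Types (x y : sphere R n) (b : bool) (i : 'I_n.+1).

Lemma mdist_sphere_itv x y : 0 <= mdist x y <= pi.
Proof. by rewrite mdist_sphereE acos_ge0 ?acos_lepi ?dotr_sphere_itv. Qed.

(** A coordinate gap is at most the chord, whose square [2 - 2 * cos d] is at most [d ^+ 2] by
    [cos_ge_quadratic]. *)
Lemma coord_dist_le_mdist x y i :
  `|(x : 'rV_n.+1) 0 i - (y : 'rV_n.+1) 0 i| <= mdist x y.
Proof.
have xyB := dotr_sphere_itv x y; have dB := mdist_sphere_itv x y.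
have d0 : 0 <= mdist x y by case/andP: dB.
rewrite -(ger0_norm d0) -ler_sqr ?nnegrE// !real_normK ?num_real//.
apply: le_trans (_ : dotr (val x - val y) (val x - val y) <= _).
  rewrite /dotr (bigD1 i)//= !mxE -expr2 lerDl sumr_ge0// => j _.
  by rewrite -expr2 sqr_ge0.
have := cos_ge_quadratic dB; rewrite {2}mdist_sphereE acosK ?in_itv//= => cosd.
rewrite !(dotrBl, dotrBr) !dotr_sphere (dotrC y) /=; lra.
Qed.

Lemma signed_sphere_subproof b x :
  dotr ((-1) ^+ b *: val x) ((-1) ^+ b *: val x) == 1.
Proof. by rewrite dotrZl dotrZr mulrA -expr2 sqrr_sign mul1r dotr_sphere. Qed.

Definition signed_sphere b x : sphere R n := Sphere (signed_sphere_subproof b x).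

Lemma signed_sphereE b x i :
  (signed_sphere b x : 'rV_n.+1) 0 i = (-1) ^+ b * (x : 'rV_n.+1) 0 i.
Proof. by rewrite mxE. Qed.

Lemma signed_sphereM b b' x :
  signed_sphere b (signed_sphere b' x) = signed_sphere (b (+) b') x.
Proof. by apply/val_inj; rewrite /= scalerA signr_addb. Qed.

Lemma mdist_signed_sphere b x y :
  mdist (signed_sphere b x) (signed_sphere b y) = mdist x y.
Proof.
by rewrite !mdist_sphereE /= dotrZl dotrZr mulrA -expr2 sqrr_sign mul1r.
Qed.

Lemma mdist_antipode x y : mdist x (signed_sphere true y) = pi - mdist x y.
Proof.
by rewrite !mdist_sphereE /= dotrZr expr1 mulN1r acosN// dotr_sphere_itv.
Qed.

Lemma signed_sphere0 x : signed_sphere false x = x.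
Proof. by apply/val_inj; rewrite /= scale1r. Qed.

(** Replacing [y] by its antipode turns the sum of coordinates into a difference, a lower bound for
    [pi - mdist x y]. For two points of one cap this bounds the diameter. *)
Lemma mdist_le_coordD b i (t : R) x y :
  t <= (signed_sphere b x : 'rV_n.+1) 0 i + (signed_sphere b y : 'rV_n.+1) 0 i ->
  mdist x y <= pi - t.
Proof.
move=> t_le; rewrite lerBrDl -lerBrDr -mdist_antipode -(mdist_signed_sphere b).
apply: le_trans (coord_dist_le_mdist _ _ i); apply: le_trans (ler_norm _).
rewrite signed_sphereM addbC -signed_sphereM (signed_sphereE true).
by rewrite expr1 mulN1r opprK.
Qed.

Lemma sphere_axis_subproof i :
  dotr (delta_mx 0 i : 'rV[R]_n.+1) (delta_mx 0 i) == 1.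
Proof.
rewrite /dotr (bigD1 i)//= mxE !eqxx mulr1 big1 ?addr0// => j ji.
by rewrite mxE (negbTE ji) andbF mulr0.
Qed.

Definition sphere_axis i : sphere R n := Sphere (sphere_axis_subproof i).

Lemma sphere_axis_coord i : (sphere_axis i : 'rV_n.+1) 0 i = 1.
Proof. by rewrite mxE !eqxx. Qed.

(** The squared coordinates have average [1 / n.+1], so one of them reaches it; [b] is the sign of
    that coordinate. *)
Lemma sphere_large_coord x : exists i b,
  (Num.sqrt n.+1%:R)^-1 <= (signed_sphere b x : 'rV_n.+1) 0 i.
Proof.
have [i xi] : exists i, n.+1%:R^-1 <= ((x : 'rV_n.+1) 0 i) ^+ 2.
  apply/not_existsP => xlt; have := dotr_sphere x; apply/eqP; rewrite lt_eqF//.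
  have -> : 1 = \sum_(i < n.+1) n.+1%:R^-1 :> R.
    by rewrite sumr_const card_ord -[RHS]mulr_natr mulVf.
  apply: ltr_sum; first by apply/hasP; exists ord0; rewrite ?mem_index_enum.
  by move=> i _; rewrite -expr2 ltNge; apply/negP/xlt.
exists i, ((x : 'rV_n.+1) 0 i < 0); rewrite signed_sphereE -normrEsign.
by rewrite -sqrtrV// -sqrtr_sqr ler_wsqrtr.
Qed.

End SphereGeometry.

(** * Isometric inclusion of [S^n] in [S^k] *)

Section SphereInclusion.
Context {R : realType} {n k : nat} (le_nk : (n <= k)%N).
Implicit Types x y : sphere R n.

(** The test on [j] guards [inord], whose default value beyond [n] never shows. *)
Definition pad_row (u : 'rV[R]_n.+1) : 'rV[R]_k.+1 :=
  \row_(j < k.+1) if (j < n.+1)%N then u 0 (inord j) else 0.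

Lemma dotr_pad_row u v : dotr (pad_row u) (pad_row v) = dotr u v.
Proof.
rewrite /dotr.
rewrite (eq_bigr (fun j : 'I_k.+1 => if (j < n.+1)%N then
   u 0 (inord j) * v 0 (inord j) else 0)); last first.
  by move=> j _; rewrite !mxE; case: ifP; rewrite ?mulr0.
rewrite -big_mkcond -(big_ord_widen _ (fun j => u 0 (inord j) * v 0 (inord j)))//.
by apply: eq_bigr => j _; rewrite inord_val.
Qed.

Lemma sphere_pad_subproof x :
  dotr (pad_row (val x)) (pad_row (val x)) == 1.
Proof. by rewrite dotr_pad_row dotr_sphere. Qed.

Definition sphere_pad x : sphere R k := Sphere (sphere_pad_subproof x).

Lemma mdist_sphere_pad x y : mdist (sphere_pad x) (sphere_pad y) = mdist x y.
Proof. by rewrite !mdist_sphereE dotr_pad_row. Qed.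

Lemma signed_sphere_pad b x :
  signed_sphere b (sphere_pad x) = sphere_pad (signed_sphere b x).
Proof.
by apply/val_inj/rowP => j; rewrite !mxE; case: ifP => // _; rewrite mulr0.
Qed.

End SphereInclusion.

(** * The antipodal correspondence and its distortion *)

Section AntipodalCorrespondence.
Context {R : realType} {n k : nat} (le_nk : (n <= k)%N).
Context (d : R) (p : 'I_k.+1 -> sphere R n).
Context (d_gt0 : 0 < d) (d_small : d <= 3^-1).
Context (d_cap : d <= 2 / Num.sqrt k.+1%:R).
Context (p_sep : forall b b' i j,
  mdist (signed_sphere b (p i)) (signed_sphere b' (p j)) < 3 * d ->
  b = b' /\ i = j).
Context (p_ge0 : forall i, 0 <= (sphere_pad le_nk (p i) : 'rV_k.+1) 0 i).

Let h : R := (Num.sqrt k.+1%:R)^-1.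

(* Off the balls, the relation is the inclusion of spheres; each ball around
   [± p i] is collapsed to [± e_i], except that its centre also absorbs the
   whole cap [± y_i >= h], which is what makes the relation surjective. *)
Definition cap_rel : set (sphere R n * sphere R k) := [set xy |
  (exists i b, [/\ mdist xy.1 (signed_sphere b (p i)) < d,
     h <= (signed_sphere b xy.2 : 'rV_k.+1) 0 i &
     xy.1 = signed_sphere b (p i) \/
     xy.2 = signed_sphere b (sphere_axis i)]) \/
  (forall i b, d <= mdist xy.1 (signed_sphere b (p i))) /\
  xy.2 = sphere_pad le_nk xy.1]%classic.

Lemma h_le1 : h <= 1.
Proof. by rewrite /h invf_le1 ?sqrtr_gt0// -{1}sqrtr1 ler_wsqrtr// ler1n. Qed.

Lemma cap_rel_correspondence : correspondence cap_rel.
Proof.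
split=> [x|y].
  have [[i [b xi]]|far] := pselect (exists i b,
      mdist x (signed_sphere b (p i)) < d).
    exists (signed_sphere b (sphere_axis i)); left; exists i, b; split=> //.
      by rewrite signed_sphereM addbb signed_sphere0 sphere_axis_coord h_le1.
    by right.
  exists (sphere_pad le_nk x); right; split=> // i b; rewrite leNgt.
  by apply/negP => xi; apply: far; exists i, b.
have [i [b yi]] := sphere_large_coord y.
exists (signed_sphere b (p i)); left; exists i, b; split=> //; last by left.
by rewrite mdistxx.
Qed.

Lemma cap_rel_antipode x y : cap_rel (x, y) ->
  cap_rel (signed_sphere true x, signed_sphere true y).
Proof.
move=> [[i [b [/= xi yi xy]]]|[/= far ->]]; [left|right].
  exists i, (~~ b); have sE T (z : sphere R T) :
      signed_sphere (~~ b) z = signed_sphere true (signed_sphere b z).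
    by rewrite signed_sphereM.
  split; first by rewrite sE mdist_signed_sphere.
    by rewrite signed_sphereM addbT negbK.
  by case: xy => ->; [left|right]; rewrite sE.
split=> [i b|]; last by rewrite signed_sphere_pad.
have -> : b = true (+) ~~ b by case: b.
by rewrite -signed_sphereM mdist_signed_sphere.
Qed.

(** The mixed case: [x] lies in a ball, [x'] in none. Then [x] is not the centre, as [x'] is within
    [d] of it, so [y] must be a signed axis point. *)
Lemma cap_rel_near_far x x' y y' : cap_rel (x, y) ->
    (forall i b, d <= mdist x' (signed_sphere b (p i))) ->
    y' = sphere_pad le_nk x' ->
    mdist x x' < d -> (exists i b, mdist x (signed_sphere b (p i)) < d) ->
  mdist y y' <= pi - d.
Proof.
move=> xy x'far -> xx' [j [c xj]].
case: xy => [[i [b [/= xi _ [xE|->]]]]|[/= xfar _]]; last first.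
- by have := xfar j c; rewrite leNgt xj.
(* Up to the sign [b], [x'] is within [2 * d] of [p i], so its [i]-th coordinate is at least
   [- 2 * d]; that of [y] is 1, and [1 - 2 * d >= d] by [d_small]. *)
- apply: (@mdist_le_coordD _ _ b i).
  have := coord_dist_le_mdist (signed_sphere b (sphere_pad le_nk x'))
    (sphere_pad le_nk (p i)) i.
  rewrite signed_sphere_pad mdist_sphere_pad -(mdist_signed_sphere b).
  rewrite signed_sphereM addbb signed_sphere0 => /ler_normlP[pB _].
  have := metric_triangle x' x (signed_sphere b (p i)).
  rewrite (metric_sym x' x).
  rewrite signed_sphereM addbb signed_sphere0 sphere_axis_coord.
  move: (p_ge0 i) pB xi xx' d_small; lra.
- by have := x'far i b; rewrite -xE metric_sym leNgt xx'.
Qed.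

Lemma cap_rel_close x x' y y' : cap_rel (x, y) -> cap_rel (x', y') ->
  mdist x x' < d -> mdist y y' <= pi - d.
Proof.
move=> xy x'y' xx'.
have [[i [b [/= xi yi _]]]|[/= xfar yE]] := xy;
have [[j [c [/= x'j y'j _]]]|[/= x'far y'E]] := x'y'.
(* Three hops shorter than [d] join the two centres, hence the factor 3 in [p_sep]; both images then
   lie in the same cap. *)
- have [bc ij] : b = c /\ i = j.
    apply: p_sep; apply: le_lt_trans (metric_triangle _ x _) _.
    have := metric_triangle x x' (signed_sphere c (p j)).
    rewrite (metric_sym _ x); lra.
  subst c j; apply: (@mdist_le_coordD _ _ b i).
  by apply: le_trans d_cap _; rewrite mulr2n mulrDl mul1r lerD.
- by apply: cap_rel_near_far xy x'far y'E xx' _; exists i, b.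
- rewrite metric_sym; apply: cap_rel_near_far x'y' xfar yE _ _.
    by rewrite metric_sym.
  by exists j, c.
- rewrite yE y'E mdist_sphere_pad; have := pi_ge2 R; move: d_small xx'; lra.
Qed.

Lemma cap_rel_distortion : (distortion cap_rel <= (pi - d)%:E)%E.
Proof.
have half (x x' : sphere R n) (y y' : sphere R k) :
    cap_rel (x, y) -> cap_rel (x', y') ->
    mdist y y' - mdist x x' <= pi - d.
  move=> xy x'y'; have /andP[x0 _] := mdist_sphere_itv x x'.
  have /andP[_ ypi] := mdist_sphere_itv y y'.
  have [xx'|] := ltP (mdist x x') d; last by lra.
  by have := cap_rel_close xy x'y' xx'; lra.
apply: ge_ereal_sup => _ [[x y] xy [[x' y'] x'y' <-]] /=.
rewrite lee_fin ler_norml lerNl opprB (half _ _ _ _ xy x'y')/=.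
(* Passing to antipodes replaces both distances by [pi] minus themselves, which reverses the sign of
   their difference. *)
have := half _ _ _ _ xy (cap_rel_antipode x'y').
by rewrite !mdist_antipode; lra.
Qed.

Lemma gh_dist_sphere_le_antipodal :
  (d%:E <= pi%:E - 2%:E * gh_dist (sphere R n) (sphere R k))%E.
Proof.
rewrite /gh_dist muleA -EFinM divff// mul1e.
rewrite -[d](subKr (pi : R)) [X in (X <= _)%E]EFinB leeB//.
apply: ge_ereal_inf; exists (distortion cap_rel); last exact: cap_rel_distortion.
by exists cap_rel => //; exact: cap_rel_correspondence.
Qed.

End AntipodalCorrespondence.

(* The points lie over an [m * m] grid of step [1 / 2m] in the first two
   coordinates, on the upper cap of the 2-sphere of the first three. *)
Lemma sphere_grid {R : realType} {n k m : nat} (n2 : (2 <= n)%N) :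
    (k < m * m)%N ->
  exists p : 'I_k.+1 -> sphere R n,
  [/\ forall i j, 0 <= (p i : 'rV_n.+1) 0 j,
      exists j, forall i, 2^-1 <= (p i : 'rV_n.+1) 0 j &
      forall i i', i != i' -> exists j, (2 * m%:R)^-1 <=
        `|(p i : 'rV_n.+1) 0 j - (p i' : 'rV_n.+1) 0 j|].
Proof.
case: n n2 => [|[|n]]// _ lt_km.
have m0 : (0 < m)%N by move: lt_km; case: m.
have mR0 : 0 < m%:R :> R by rewrite ltr0n.
pose g a : R := a%:R / (2 * m%:R).
have gB a : (a < m)%N -> 0 <= g a <= 2^-1.
  move=> am; rewrite divr_ge0 ?mulr_ge0//= /g ler_pdivrMr ?mulr_gt0//.
  by rewrite mulrA mulVf// mul1r ler_nat ltnW.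
have gsep a b : a != b -> (2 * m%:R)^-1 <= `|g a - g b|.
  move=> ab; rewrite -mulrBl normrM (gtr0_norm (_ : 0 < (2 * m%:R)^-1))
    ?invr_gt0 ?mulr_gt0//.
  rewrite ler_peMl ?invr_ge0 ?mulr_ge0// -[a%:R]/(a%:~R) -[b%:R]/(b%:~R).
  rewrite -intrB -intr_norm ler1z -gtz0_ge1 normr_gt0 subr_eq0.
  by apply: contra ab.
have divm (i : 'I_k.+1) : (i %/ m < m)%N.
  by rewrite ltn_divLR//; apply: leq_ltn_trans lt_km; rewrite -ltnS.
have modm (i : 'I_k.+1) : (i %% m < m)%N by rewrite ltn_mod.
pose w (i : 'I_k.+1) := Num.sqrt (1 - g (i %/ m)%N ^+ 2 - g (i %% m)%N ^+ 2).
pose c (i : 'I_k.+1) := [:: g (i %/ m)%N; g (i %% m)%N; w i].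
have wB i : 2^-1 <= w i /\ w i ^+ 2 = 1 - g (i %/ m)%N ^+ 2 - g (i %% m)%N ^+ 2.
  have /andP[u0 u1] := gB _ (divm i); have /andP[v0 v1] := gB _ (modm i).
  (* Both grid coordinates are at most 1/2, so the right-hand side is even at least 1/2. *)
  have W : 2^-1 ^+ 2 <= 1 - g (i %/ m)%N ^+ 2 - g (i %% m)%N ^+ 2 by nra.
  split; last by rewrite sqr_sqrtr// (le_trans _ W)// sqr_ge0.
  by rewrite -[X in X <= _]ger0_norm// -sqrtr_sqr ler_wsqrtr.
pose r i : 'rV[R]_n.+3 := \row_j nth 0 (c i) j.
have r1 i : dotr (r i) (r i) == 1.
  rewrite /dotr !big_ord_recl big1 => [|j _].
    by rewrite !mxE /= addr0 -!expr2 (wB i).2; apply/eqP; ring.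
  by rewrite !mxE /= nth_nil mulr0.
exists (fun i => Sphere (r1 i)); split=> [i j||i i' ii'].
- rewrite mxE; have /andP[u0 _] := gB _ (divm i).
  have /andP[v0 _] := gB _ (modm i); have w0 : 0 <= w i by exact: sqrtr_ge0.
  by case: j => -[|[|[|j]]] //= _; rewrite nth_nil.
- by exists (inord 2) => i; rewrite mxE inordK//; exact: (wB i).1.
(* Distinct indices differ in their quotient or their remainder modulo [m]. *)
have [dE|dN] := eqVneq (i %/ m)%N (i' %/ m)%N; last first.
  by exists (inord 0); rewrite !mxE inordK//=; exact: gsep.
exists (inord 1); rewrite !mxE inordK//=; apply: gsep.
by apply: contra ii' => /eqP mE; apply/eqP/val_inj => /=;
  rewrite (divn_eq i m) dE mE -divn_eq.
Qed.

Theorem corollary1p4 (R : realType) (n : nat) (hn : (2 <= n)%N) :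
  exists c : R, 0 < c /\
    forall k : nat, (n < k)%N ->
      ((c / Num.sqrt k%:R)%:E <=
         pi%:E - 2%:E * gh_dist (sphere R n) (sphere R k))%E.
Proof.
(* With [d = 1 / (12 * s)], the required separation [3 * d = 1 / (4 * s)] is at most the grid step
   [1 / (2 * m)], because [m <= 2 * s]. *)
exists 12^-1; split=> [|k lt_nk]; first by rewrite invr_gt0.
have k1 : (1 <= k)%N by apply: leq_trans lt_nk.
pose s : R := Num.sqrt k%:R.
have s1 : 1 <= s by rewrite -sqrtr1 ler_wsqrtr// ler1n.
have s2 : s ^+ 2 = k%:R by rewrite sqr_sqrtr.
pose m := (Num.trunc s).+1.
have sm : s < m%:R by exact: truncnS_gt.
have ms : m%:R <= 2 * s.
  have /andP[tr _] : _ && _ := truncn_itv (le_trans ler01 s1).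
  by rewrite /m -natr1; lra.
have lt_km : (k < m * m)%N by rewrite -(ltr_nat R) natrM -s2; nra.
have [p [p0 [j0 pj0] psep]] := sphere_grid (R := R) hn lt_km.
have si : s^-1 <= 1 by rewrite invf_le1//; lra.
have si0 : 0 < s^-1 by rewrite invr_gt0; lra.
apply: (@gh_dist_sphere_le_antipodal _ _ _ (ltnW lt_nk) _ p); rewrite -/s.
- lra.
- lra.
(* This amounts to [k + 1 <= 4 * k]. *)
- have : s^-1 <= 2 / Num.sqrt k.+1%:R.
    rewrite ler_pdivlMr ?sqrtr_gt0// mulrC ler_pdivrMr; last by lra.
    rewrite -ler_sqr ?nnegrE ?sqrtr_ge0//; last by lra.
    rewrite exprMn sqr_sqrtr// -(natr1 k) -s2; nra.
  lra.
- move=> b b' i i' close.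
  (* With opposite signs, the coordinates [j0] differ by at least 1, more than [3 * d]. *)
  have bb' : b = b'.
    apply/eqP/negPn/negP => bb'; move: close; rewrite ltNge => /negP; apply.
    apply: le_trans (coord_dist_le_mdist _ _ j0); rewrite !signed_sphereE.
    have -> : b' = ~~ b by case: b b' bb' => -[].
    rewrite signrN mulNr opprK -mulrDr normrM normr_sign mul1r.
    apply: le_trans (ler_norm _); move: (pj0 i) (pj0 i'); lra.
  split=> //; subst b'; apply/eqP/negPn/negP => ii'; move: close.
  rewrite mdist_signed_sphere ltNge => /negP; apply.
  have [j] := psep _ _ ii'; move=> /le_trans/(_ (coord_dist_le_mdist _ _ _)).
  apply: le_trans; have -> : 3 * (12^-1 / s) = (4 * s)^-1.
    by rewrite invfM; field; lra.
  by rewrite lef_pV2 ?posrE; lra.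
- by move=> i; rewrite mxE; case: ifP => // _; exact: p0.
Qed.
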